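(* Let $\mathcal{A}$ be a set of real $m\times m$ Vandergraft matrices that share a common dominant eigenvector $x$ (i.e. $x\in\mathbb{R}^m$, $x\neq0$, and $Ax=\rho(A)x$ for all $A\in\mathcal{A}$) and satisfy at least one of the following two conditions: (1) the matrices in $\mathcal{A}$ are simultaneously similar, with a real similarity matrix, to normal matrices (there is a real invertible $S$ such that $S^{-1}AS$ is normal for every $A\in\mathcal{A}$); (2) $\mathcal{A}$ is finite, the matrices in $\mathcal{A}$ commute, and for every $A\in\mathcal{A}$, $\rho(A)$ is a semisimple eigenvalue of $A$, i.e., a simple root of the minimal polynomial of $A$. Then the matrices in $\mathcal{A}$ have a common invariant proper cone $\mathcal{K}$ with the additional property that $x$ belongs to the interior of $\mathcal{K}$.
   Context: All matrices are real; $\rho(A)$ is the spectral radius. A set $\mathcal{K}\subseteq\mathbb{R}^m$ is a cone if $a\mathcal{K}\subseteq\mathcal{K}$ for all $a\ge 0$; a cone is proper if it is convex ($\mathcal{K}+\mathcal{K}\subseteq\mathcal{K}$), closed, pointed ($\mathcal{K}\cap-\mathcal{K}=\{0\}$) and solid (nonempty interior). $\mathcal{K}$ is invariant under $A$ if $Ay\in\mathcal{K}$ for all $y\in\mathcal{K}$. A real $m\times m$ matrix $A$ is a Vandergraft matrix if (a) $\rho(A)$ is an eigenvalue of $A$, and (b) $\deg\rho(A)\ge\deg\lambda$ for every eigenvalue $\lambda$ of $A$ with $|\lambda|=\rho(A)$, where $\deg\lambda$ is the multiplicity of $\lambda$ as a root of the minimal polynomial of $A$. A dominant eigenvector of $A$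 is an eigenvector corresponding to $\rho(A)$. *)

(* Defs.v *)
From HB Require Import structures.
From mathcomp Require Import all_boot all_order all_algebra.
From mathcomp Require Import complex.
From mathcomp Require Import all_classical all_reals all_analysis.
Set Implicit Arguments.
Unset Strict Implicit.
Unset Printing Implicit Defensive.
Import Order.TTheory GRing.Theory Num.Theory.
Import numFieldNormedType.Exports.
Local Open Scope classical_set_scope.
Local Open Scope ring_scope.

(* Matrices have size m.+1 because [mxminpoly] is only defined for nonempty
   square matrices; a nonzero vector only exists in positive dimension.
   [eigenvalue] is stated with row eigenvectors, which for a square matrix
   gives the same eigenvalues as column eigenvectors. *)

Definition complexify (R : realType) (m : nat) (A : 'M[R]_m.+1) :
    'M[R[i]]_m.+1 :=
  map_mx (real_complex R) A.

(* The supremum is a maximum: the set is finite and nonempty. *)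
Definition spectral_radius (R : realType) (m : nat) (A : 'M[R]_m.+1) : R :=
  sup [set ComplexField.Normc.normc z | z in
         [set z : R[i] | eigenvalue (complexify A) z]].

(* The minimal polynomial of A is the same over R and over R[i]. *)
Definition eigen_degree (R : realType) (m : nat) (A : 'M[R]_m.+1) (z : R[i]) :
    nat :=
  mup z (map_poly (real_complex R) (mxminpoly A)).

Definition vandergraft (R : realType) (m : nat) (A : 'M[R]_m.+1) : Prop :=
  eigenvalue A (spectral_radius A) /\
  forall z : R[i], eigenvalue (complexify A) z ->
    ComplexField.Normc.normc z = spectral_radius A ->
    (eigen_degree A z <= eigen_degree A (real_complex R (spectral_radius A)))%N.

Definition is_cone (R : realType) (m : nat) (K : set 'cV[R]_m.+1) : Prop :=
  forall (a : R) (y : 'cV[R]_m.+1), 0 <= a -> K y -> K (a *: y).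

Definition proper_cone (R : realType) (m : nat) (K : set 'cV[R]_m.+1) : Prop :=
  [/\ is_cone K,
      forall y z : 'cV[R]_m.+1, K y -> K z -> K (y + z),
      closed K,
      K `&` [set - y | y in K] = [set 0] &
      interior K !=set0].

Definition invariant_under (R : realType) (m : nat) (K : set 'cV[R]_m.+1)
    (A : 'M[R]_m.+1) : Prop :=
  forall y : 'cV[R]_m.+1, K y -> K (A *m y).

Definition normal_real_mx (R : realType) (m : nat) (A : 'M[R]_m.+1) : Prop :=
  A *m A^T = A^T *m A.

Definition simultaneously_similar_to_normal (R : realType) (m : nat)
    (F : set 'M[R]_m.+1) : Prop :=
  exists2 S : 'M[R]_m.+1, S \in unitmx &
    forall A : 'M[R]_m.+1, F A -> normal_real_mx (invmx S *m A *m S).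

(* An eigenvalue is semisimple when it is a simple root of the minimal
   polynomial. *)
Definition finite_commuting_semisimple (R : realType) (m : nat)
    (F : set 'M[R]_m.+1) : Prop :=
  [/\ finite_set F,
      forall A B : 'M[R]_m.+1, F A -> F B -> A *m B = B *m A &
      forall A : 'M[R]_m.+1, F A ->
        eigen_degree A (real_complex R (spectral_radius A)) = 1%N].

(* Main.v *)
(* Under either condition there is a row vector [phi] with [phi x = 1] and
   [phi A = rho(A) phi] for all [A] in the family, and the semigroup generated by
   the family is bounded in the sense that a product [T = A_1 ... A_k] satisfies
   [|T| <= C rho(A_1) ... rho(A_k)]. The cone of all [y] such that
   [|T (y - phi(y) x)| <= rho(A_1) ... rho(A_k) phi(y)] for every such product is
   then proper and invariant, and contains [x] in its interior.

   In the normal case, a right eigenvector of a normal matrix for a real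
   eigenvalue is also a left eigenvector, and each matrix is a contraction up to
   the factor [rho(A)] for the Euclidean norm. In the commuting case, [phi] comes
   from the product of the eigenprojections [q(A) / q(rho(A))], where
   [(X - rho(A)) q] is the minimal polynomial of [A]; and since all peripheral
   eigenvalues are simple roots of the minimal polynomial, the powers of each
   [A] are bounded by a multiple of [rho(A)^k]. *)

Require Import Defs.
From HB Require Import structures.
From mathcomp Require Import all_boot all_order all_algebra.
From mathcomp Require Import complex spectral.
From mathcomp Require Import all_classical all_reals all_analysis.
Set Implicit Arguments.
Unset Strict Implicit.
Unset Printing Implicit Defensive.
Import Order.TTheory GRing.Theory Num.Theory.
Import numFieldNormedType.Exports.
Local Open Scope classical_set_scope.
Local Open Scope ring_scope.

(** * The entrywise maximum norm of matrices *)

Lemma mx_norm_ge_entry (K : numDomainType) (m n : nat) (A : 'M[K]_(m, n)) i j :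
  `|A i j| <= `|A|.
Proof.
rewrite [leRHS]/Num.norm/= mx_normE -[leLHS]nngE num_le.
exact: (le_bigmax _ (fun ij => `|A ij.1 ij.2|%:nng) (i, j)).
Qed.

Lemma mx_norm_le (K : numDomainType) (m n : nat) (A : 'M[K]_(m, n)) (c : K) :
  0 <= c -> (forall i j, `|A i j| <= c) -> `|A| <= c.
Proof.
move=> c0 Ac; change (mx_norm A <= c).
by have [->//|/mx_norm_neq0[ij ->]] := eqVneq (mx_norm A) 0.
Qed.

(** The norm is the largest absolute value of an entry, which is not submultiplicative; [n] counts
    the terms in an entry of the product. *)
Lemma mx_norm_mul (K : numDomainType) (m n p : nat)
    (A : 'M[K]_(m, n)) (B : 'M[K]_(n, p)) :
  `|A *m B| <= n%:R * `|A| * `|B|.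
Proof.
apply: mx_norm_le => [|i j]; first by rewrite !mulr_ge0.
rewrite mxE (le_trans (ler_norm_sum _ _ _))//.
rewrite -mulrA mulr_natl -[X in _ *+ X]card_ord -sumr_const.
by apply: ler_sum => k _; rewrite normrM ler_pM ?mx_norm_ge_entry.
Qed.

Lemma mulmx_continuous (R : realType) (m n : nat) (A : 'M[R]_(m.+1, n.+1)) :
  continuous (mulmx A : 'cV[R]_n.+1 -> 'cV[R]_m.+1).
Proof.
apply/linear_bounded_continuous; apply/linear_boundedP.
near=> r => x; apply: le_trans (mx_norm_mul _ _) _.
apply: ler_wpM2r; first by [].
by near: r; apply: nbhs_pinfty_ge; rewrite num_real.
Unshelve. all: by end_near. Qed.

(** * The cone cut out by the semigroup of products *)

Section SemigroupCone.
Variables (R : realType) (m : nat) (F : set 'M[R]_m.+1).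
Variables (rho : 'M[R]_m.+1 -> R) (x : 'cV[R]_m.+1) (phi : 'rV[R]_m.+1).
Hypothesis phix : phi *m x = 1%:M.
Hypothesis rho_ge0 : forall A, F A -> 0 <= rho A.
Hypothesis Fx : forall A, F A -> A *m x = rho A *: x.
Hypothesis phiF : forall A, F A -> phi *m A = rho A *: phi.

Definition semigroup_cone : set 'cV[R]_m.+1 :=
  [set y | forall s : seq 'M[R]_m.+1, (forall A, A \in s -> F A) ->
    `|(\prod_(A <- s) A) *m (y - x *m (phi *m y))|
      <= (\prod_(A <- s) rho A) * (phi *m y) 0 0].

Let prod_rho_ge0 s : (forall A, A \in s -> F A) -> 0 <= \prod_(A <- s) rho A.
Proof. by move=> sF; rewrite big_seq prodr_ge0// => A /sF/rho_ge0. Qed.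

Lemma semigroup_cone_is_cone : is_cone semigroup_cone.
Proof.
move=> a y a0 Ky s sF; rewrite -!scalemxAr -scalerBr -scalemxAr normrZ ger0_norm//.
by rewrite mxE mulrCA ler_wpM2l// Ky.
Qed.

Lemma semigroup_coneD y z :
  semigroup_cone y -> semigroup_cone z -> semigroup_cone (y + z).
Proof.
move=> Ky Kz s sF; rewrite [phi *m _]mulmxDr [x *m _]mulmxDr opprD addrACA mulmxDr.
apply: le_trans (ler_normD _ _) _.
by rewrite mxE mulrDr; apply: lerD; [apply: Ky|apply: Kz].
Qed.

(** Two constants, for two uses: [a = 1] for closedness, [b = 1] for the neighbourhood of [x]. *)
Let gap_continuous a (B : 'M[R]_m.+1) b :
  continuous (fun y : 'cV[R]_m.+1 => a * `|B *m y| - b * (phi *m y) 0 0).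
Proof.
move=> y.
have cB : `|B *m z| @[z --> y] --> `|B *m y|.
  apply: (@cvg_comp _ _ _ (mulmx B) Num.norm); last exact: norm_continuous.
  exact: mulmx_continuous.
have cphi : (phi *m z) 0 0 @[z --> y] --> (phi *m y) 0 0.
  apply: (@cvg_comp _ _ _ (mulmx phi) (fun M : 'cV[R]_1 => M 0 0)).
    exact: mulmx_continuous.
  exact: coord_continuous.
exact: (cvgB (cvgMl_tmp cB) (cvgMl_tmp cphi)).
Qed.

Lemma semigroup_cone_closed : closed semigroup_cone.
Proof.
rewrite (_ : semigroup_cone = \bigcap_(s in [set s : seq 'M[R]_m.+1 |
    forall A, A \in s -> F A]) [set y |
    `|(\prod_(A <- s) A) *m (1%:M - x *m phi) *m y| -
      (\prod_(A <- s) rho A) * (phi *m y) 0 0 <= 0]); last first.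
  apply/seteqP; split=> y /= Ky s /Ky;
    by rewrite /= subr_le0 -!mulmxA mulmxBl mul1mx -!mulmxA.
apply: closed_bigI => s _.
have /continuous_closedP/(_ _ (@closed_le R 0)) := @gap_continuous
  1 (\prod_(A <- s) A *m (1%:M - x *m phi)) (\prod_(A <- s) rho A).
by under [X in closed X -> _]eq_set => y do rewrite mul1r.
Qed.

(** The empty product gives [|y - phi(y) x| <= phi(y)]. So [phi] is nonnegative on the cone and
    vanishes at [y] if [-y] is there too; the same inequality then forces [y = 0]. *)
Lemma semigroup_cone_pointed :
  semigroup_cone `&` [set - y | y in semigroup_cone] = [set 0].
Proof.
apply/seteqP; split=> [y [Ky [z Kz zy]]|_ ->]; last first.
  have K0 : semigroup_cone 0.
    by move=> s _; rewrite !mulmx0 subr0 mulmx0 normr0 mxE mulr0.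
  by split=> //; exists 0; rewrite ?oppr0.
have nilF : forall A : 'M[R]_m.+1, A \in [::] -> F A by [].
move: (Ky _ nilF) (Kz _ nilF); rewrite !big_nil !mul1r !mul1mx.
rewrite -zy !mulmxN -opprD normrN [X in _ <= X -> _]mxE => phiz1 phiz2.
have phiz : (phi *m z) 0 0 = 0.
  apply/eqP; rewrite eq_le -[_ <= 0]oppr_ge0.
  by rewrite (le_trans _ phiz1)// (le_trans _ phiz2).
move: phiz2; rewrite phiz.
rewrite [phi *m z]mx11_scalar phiz raddf0 mulmx0 subr0 normr_le0 => /eqP->.
by rewrite oppr0.
Qed.

(** [A] commutes with the projection [x *m phi], because [x] and [phi] are eigenvectors for the same
    [rho A]. The constraint of [s] at [A *m y] therefore follows from that of [rcons s A] at [y]. *)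
Lemma semigroup_cone_invariant A : F A -> invariant_under semigroup_cone A.
Proof.
move=> FA y Ky s sF.
have /Ky : forall B, B \in rcons s A -> F B.
  by move=> B; rewrite mem_rcons inE => /orP[/eqP->//|/sF].
rewrite !big_rcons/= -mulmxE -[X in `|X|]mulmxA -mulrA.
rewrite mulmxBr [A *m (x *m _)]mulmxA Fx// [phi *m (A *m y)]mulmxA phiF//.
by rewrite -!scalemxAl -scalemxAr [X in _ -> _ <= _ * X]mxE.
Qed.

(** By the uniform bound, a single strict inequality implies all the constraints. It holds at [x],
    where the norm term vanishes and [phi] is 1, and persists nearby by continuity. *)
Lemma semigroup_cone_interior (C : R) :
  (forall s : seq 'M[R]_m.+1, (forall A, A \in s -> F A) ->
    `|\prod_(A <- s) A| <= C * \prod_(A <- s) rho A) ->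
  interior semigroup_cone x.
Proof.
move=> FC; pose D := m.+1%:R * C.
suff : \forall y \near x, D * `|(1%:M - x *m phi) *m y| - (phi *m y) 0 0 < 0.
  apply: filterS => y; rewrite subr_lt0 => /ltW Dy s sF.
  rewrite (le_trans (mx_norm_mul _ _))//.
  rewrite mulmxBl mul1mx -mulmxA in Dy.
  rewrite (le_trans _ (ler_wpM2l (prod_rho_ge0 sF) Dy))//.
  rewrite (mulrC (\prod_(A <- s) _)) [leRHS]mulrAC ler_wpM2r//.
  by rewrite /D -mulrA ler_wpM2l// FC.
pose f (y : 'cV[R]_m.+1) := D * `|(1%:M - x *m phi) *m y| - (phi *m y) 0 0.
have fx : f x < 0.
  rewrite /f mulmxBl mul1mx -mulmxA phix mulmx1 subrr normr0 mulr0 sub0r mxE.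
  by rewrite oppr_lt0 ltr01.
have cf : {for x, continuous f}.
  have := @gap_continuous D (1%:M - x *m phi) 1 x.
  by rewrite /f /prop_for /continuous_at; under eq_fun do rewrite mul1r; rewrite mul1r.
exact: (@cvgr_lt R _ _ _ f (f x) cf 0 fx).
Qed.

End SemigroupCone.

Lemma invariant_cone_of_bounded_semigroup (R : realType) (m : nat)
    (F : set 'M[R]_m.+1) (rho : 'M[R]_m.+1 -> R) (x : 'cV[R]_m.+1)
    (phi : 'rV[R]_m.+1) (C : R) :
  phi *m x = 1%:M ->
  (forall A, F A -> 0 <= rho A) ->
  (forall A, F A -> A *m x = rho A *: x) ->
  (forall A, F A -> phi *m A = rho A *: phi) ->
  (forall s : seq 'M[R]_m.+1, (forall A, A \in s -> F A) ->
    `|\prod_(A <- s) A| <= C * \prod_(A <- s) rho A) ->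
  exists K : set 'cV[R]_m.+1,
    [/\ proper_cone K,
        forall A : 'M[R]_m.+1, F A -> invariant_under K A &
        interior K x].
Proof.
move=> phix rho0 Fx phiF FC; exists (semigroup_cone F rho x phi).
have Kx := semigroup_cone_interior phix rho0 FC.
split=> //; last by move=> A FA; exact: semigroup_cone_invariant.
split.
- exact: semigroup_cone_is_cone.
- exact: semigroup_coneD.
- exact: semigroup_cone_closed.
- exact: semigroup_cone_pointed.
- by exists x.
Qed.

(** * Growth of powers and roots of the minimal polynomial *)

(* A peripheral root [z] is split off through [Y = q(A) Y / q(z) + Y2], where
   [q] is the product of the remaining factors: [A] acts on the first summand
   as [z], and [q(A) Y2 = 0]. *)
Lemma power_bounded_of_roots (K : numFieldType) (n : nat) (A : 'M[K]_n.+1) (r : K)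
    (s : seq K) (Y : 'M[K]_n.+1) :
  (forall z, z \in s -> `|z| <= r) ->
  (forall z, `|z| = r -> (count_mem z s <= 1)%N) ->
  horner_mx A (\prod_(z <- s) ('X - z%:P)) * Y = 0 ->
  exists C, forall k, `|A ^+ k * Y| <= C * r ^+ k.
Proof.
elim: s Y => [|z s IHs] Y s_le s_count.
  rewrite big_nil rmorph1 mul1r => ->; exists 0 => k.
  by rewrite mulr0 normr0 mul0r.
have z_le : `|z| <= r by rewrite s_le ?mem_head.
have r0 : 0 <= r by exact: le_trans z_le.
have {}IHs := IHs _ (fun y ys => s_le y (@mem_behead _ (z :: s) y ys))
  (fun y yr => leq_trans (leq_addl _ _) (s_count y yr)).
rewrite big_cons; set q := \prod_(_ <- s) _ => qY.
(* If [|z| < r], then [A^(k+1) Y = z A^k Y + A^k (A - z) Y], where the induction hypothesis bounds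
   the last term. *)
have [zr|zr] := eqVneq `|z| r; last first.
  have {zr} rz : 0 < r - `|z| by rewrite subr_gt0 lt_neqAle zr.
  have [|C CZ] := IHs ((A - z%:M) * Y).
    by rewrite mulrA -qY mulrC rmorphM/= rmorphB/= horner_mx_X horner_mx_C.
  have C0 : 0 <= C by have := CZ 0; rewrite expr0 mulr1; apply: le_trans.
  (* The first summand covers [k = 0]; the second gives [|z| D + C <= r D], the induction step on
     [k]. *)
  pose D := `|Y| + C / (r - `|z|); exists D.
  have D0 : 0 <= D by rewrite addr_ge0// divr_ge0// ltW.
  elim=> [|k IHk]; first by rewrite !expr0 mul1r mulr1 lerDl divr_ge0// ltW.
  have -> : A ^+ k.+1 * Y = z *: (A ^+ k * Y) + A ^+ k * ((A - z%:M) * Y).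
    rewrite mulrBl mulrBr mulrA -exprSr -mulmxE mul_scalar_mx mulmxE.
    by rewrite -scalerAr addrC subrK.
  apply: le_trans (ler_normD _ _) _; rewrite normrZ.
  apply: le_trans (lerD (ler_wpM2l (normr_ge0 z) IHk) (CZ k)) _.
  rewrite mulrA -mulrDl exprS mulrA ler_wpM2r ?exprn_ge0//.
  rewrite -lerBrDl [`|z| * D]mulrC -mulrBr mulrDl divfK ?gt_eqF//.
  by rewrite lerDr mulr_ge0// ltW.
(* On the circle, [z] occurs only once in [z :: s], so it is not a root of [q]. *)
have qz : q.[z] != 0.
  rewrite -/(root q z) root_prod_XsubC -has_pred1 has_count -leqNgt.
  by have := s_count z zr; rewrite /= eqxx add1n ltnS.
have [t Dt] : exists t, q - q.[z]%:P = t * ('X - z%:P).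
  by apply/factor_theorem; rewrite /root !hornerE subrr.
pose Y1 := q.[z]^-1 *: (horner_mx A q * Y).
have AY1 k : A ^+ k * Y1 = z ^+ k *: Y1.
  elim: k => [|k IHk]; first by rewrite !expr0 mul1r scale1r.
  have AY1 : A * Y1 = z *: Y1.
    apply/eqP; rewrite -subr_eq0 -[z *: Y1]mul_scalar_mx mulmxE.
    rewrite -mulrBl /Y1 -scalerAr mulrA.
    rewrite -(horner_mx_C A z) -[in X in (X - _) * _](horner_mx_X A).
    by rewrite -rmorphB -rmorphM qY scaler0.
  by rewrite exprSr -mulrA AY1 -scalerAr IHk scalerA -exprS.
(* [Y - Y1] is a multiple of [(q - q(z))(A) Y], and [q - q(z)] is divisible by [X - z], so [q(A)]
   kills it. *)
have [|C CY] := IHs (Y - Y1).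
  have -> : Y - Y1 = - q.[z]^-1 *: (horner_mx A (q - q.[z]%:P) * Y).
    rewrite rmorphB/= mulrBl horner_mx_C scaleNr scalerBr opprB; congr (_ - _).
    by rewrite -mulmxE mul_scalar_mx scalerA mulVf// scale1r.
  rewrite -scalerAr mulrA -rmorphM Dt mulrCA [q * _]mulrC rmorphM -mulrA qY.
  by rewrite mulr0 scaler0.
exists (`|Y1| + C) => k.
rewrite -[Y in _ * Y](subrK Y1) addrC mulrDr (le_trans (ler_normD _ _))//.
by rewrite mulrDl lerD// AY1 normrZ normrX zr mulrC.
Qed.

Lemma normc_normE (R : realType) (z : R[i]) :
  (ComplexField.Normc.normc z)%:C%C = `|z|.
Proof. by rewrite normc_def; case: z. Qed.

Lemma normc_le_spectral_radius (R : realType) (m : nat) (A : 'M[R]_m.+1)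
    (z : R[i]) :
  eigenvalue (complexify A) z -> ComplexField.Normc.normc z <= spectral_radius A.
Proof.
move=> Az; apply: ub_le_sup; last by exists z.
have [rs Drs] := closed_field_poly_normal (char_poly (complexify A)).
(* Any upper bound will do here; the moduli of all the roots of the characteristic polynomial are
   summed. *)
exists (\sum_(y <- rs) ComplexField.Normc.normc y) => _ [y /= + <-].
rewrite eigenvalue_root_char Drs (eqP (char_poly_monic _)) scale1r.
rewrite root_prod_XsubC => yrs.
rewrite (big_rem y yrs)/= lerDl sumr_ge0// => w _.
by rewrite -lecR normc_normE normr_ge0.
Qed.

Lemma eigenvalue_norm_le (R : realType) (m : nat) (A : 'M[R]_m.+1) (z : R[i]) :
  eigenvalue (complexify A) z -> `|z| <= (spectral_radius A)%:C%C.
Proof. by rewrite -normc_normE lecR; exact: normc_le_spectral_radius. Qed.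

Lemma spectral_radius_ge0 (R : realType) (m : nat) (A : 'M[R]_m.+1) :
  0 <= spectral_radius A.
Proof.
have [z Az] := eigenvalue_closed (complexify A) (ltn0Sn m).
by rewrite -lecR (le_trans _ (eigenvalue_norm_le Az))// normr_ge0.
Qed.

(** The bound from the roots is used over [R[i]] with the minimal polynomial and [Y = 1], then read
    back over [R] entry by entry. *)
Lemma power_bounded_of_degree (R : realType) (m : nat) (A : 'M[R]_m.+1) :
  (forall z : R[i], eigenvalue (complexify A) z ->
    ComplexField.Normc.normc z = spectral_radius A -> (eigen_degree A z <= 1)%N) ->
  exists C, forall k, `|A ^+ k| <= C * spectral_radius A ^+ k.
Proof.
move=> degA.
have [s Ds] := closed_field_poly_normal (mxminpoly (complexify A)).
rewrite (eqP (mxminpoly_monic _)) scale1r in Ds.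
have s_eig z : z \in s -> eigenvalue (complexify A) z.
  by rewrite eigenvalue_root_min Ds root_prod_XsubC.
have [||| C AC] := @power_bounded_of_roots _ _ (complexify A)
  (spectral_radius A)%:C%C s 1.
- by move=> z /s_eig/eigenvalue_norm_le.
- move=> z zr; have [/s_eig Az|/count_memPn->//] := boolP (z \in s).
  rewrite -mu_prod_XsubC -Ds mxminpoly_map; apply: degA => //.
  by apply: (complexI (R := R)); rewrite normc_normE.
- by rewrite -Ds mx_root_minpoly mul0r.
have C0 : 0 <= C by have := le_trans (normr_ge0 _) (AC 0); rewrite [_ ^+ 0]expr0 mulr1.
(* [C] is nonnegative in [R[i]], hence real and equal to its real part. *)
exists (complex.Re C) => k; apply: mx_norm_le => [|i j].
  by rewrite mulr_ge0 ?exprn_ge0 ?spectral_radius_ge0// -lecR RRe_real// ger0_real.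
rewrite -lecR rmorphM rmorphXn/= RRe_real ?ger0_real//.
apply: le_trans (AC k); rewrite mulr1 -rmorphXn/=.
apply: le_trans (mx_norm_ge_entry _ i j); rewrite mxE.
by rewrite -normc_normE /= expr0n addr0 sqrtr_sqr.
Qed.

(** * Commuting families with semisimple dominant eigenvalues *)

Lemma semisimple_eigenprojection (R : realType) (m : nat) (A : 'M[R]_m.+1)
    (a : R) (x : 'cV[R]_m.+1) :
  eigenvalue A a -> eigen_degree A (real_complex R a) = 1%N -> A *m x = a *: x ->
  exists P : 'M[R]_m.+1, [/\ P *m x = x, P *m A = a *: P &
    forall B : 'M[R]_m.+1, A *m B = B *m A -> P *m B = B *m P].
Proof.
rewrite eigenvalue_root_min => /factor_theorem[q Dq] degA Ax.
have Aq : horner_mx A q *m A = a *: horner_mx A q.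
  apply/eqP; rewrite -subr_eq0 -mul_mx_scalar -mulmxBr mulmxE.
  rewrite -(horner_mx_C A a) -[in X in _ * (X - _)](horner_mx_X A) -rmorphB -rmorphM.
  by rewrite -Dq; apply/eqP/mx_root_minpoly.
have hx p : horner_mx A p *m x = p.[a] *: x.
  elim/poly_ind: p => [|p c IHp]; first by rewrite rmorph0 mul0mx horner0 scale0r.
  rewrite rmorphD rmorphM/= horner_mx_X horner_mx_C !hornerE mulmxDl -mulmxE.
  by rewrite -mulmxA Ax -scalemxAr IHp scalerA mul_scalar_mx -scalerDl mulrC.
(* Otherwise [a] would be at least a double root of the minimal polynomial. *)
have qa : q.[a] != 0.
  apply/negP => /factor_theorem[t Dt]; move: degA; apply/eqP.
  rewrite gtn_eqF// /eigen_degree mup_geq; last first.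
    by rewrite map_poly_eq0 monic_neq0// mxminpoly_monic.
  rewrite Dq Dt -mulrA -expr2 rmorphM rmorphXn/= rmorphB/= map_polyX map_polyC.
  by rewrite dvdp_mull.
exists (q.[a]^-1 *: horner_mx A q); split.
- by rewrite -scalemxAl hx scalerA mulVf// scale1r.
- by rewrite -scalemxAl Aq !scalerA mulrC.
- by move=> B AB; rewrite -scalemxAl -scalemxAr (comm_horner_mx q AB).
Qed.

(** The map [f] allows the same splitting for a product of matrices and for the product of their
    [rho]. *)
Lemma prodr_split_commuting (T : eqType) (K : nzRingType) (f : T -> K) (a : T)
    (s : seq T) :
  (forall b, b \in s -> GRing.comm (f a) (f b)) ->
  \prod_(b <- s) f b =
  f a ^+ count_mem a s * \prod_(b <- [seq b <- s | b != a]) f b.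
Proof.
elim: s => [|b s IHs] fab; first by rewrite !big_nil expr0 mulr1.
rewrite big_cons IHs/=; last by move=> c cs; apply: fab; rewrite inE cs orbT.
have [->|_] /= := eqVneq b a; first by rewrite exprS mulrA.
rewrite big_cons !mulrA; congr (_ * _).
by apply/commrX/commr_sym/fab; rewrite mem_head.
Qed.

(** All factors equal to the head of [l] are gathered into one power, and the others lie in the
    tail. Each element of [l] thus multiplies the constant once, however long [s] is. *)
Lemma bounded_commuting_semigroup (R : realType) (m : nat) (l : seq 'M[R]_m.+1)
    (rho : 'M[R]_m.+1 -> R) :
  (forall A, A \in l -> 0 <= rho A) ->
  (forall A B, A \in l -> B \in l -> A *m B = B *m A) ->
  (forall A, A \in l -> exists C, forall k, `|A ^+ k| <= C * rho A ^+ k) ->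
  exists C, forall s : seq 'M[R]_m.+1, {subset s <= l} ->
    `|\prod_(A <- s) A| <= C * \prod_(A <- s) rho A.
Proof.
elim: l => [|A l IHl] rho0 lC lB.
  exists `|1 : 'M[R]_m.+1| => -[|A s] sl; first by rewrite !big_nil mulr1.
  by have := sl A (mem_head _ _).
have [D AD] := lB A (mem_head _ _).
have lAl B : B \in l -> B \in A :: l by move=> Bl; rewrite inE Bl orbT.
have [|||C lC'] := IHl.
- by move=> B /lAl/rho0.
- by move=> B B' /lAl Bl /lAl; apply: lC.
- by move=> B /lAl/lB.
exists (m.+1%:R * D * C) => s sl.
rewrite (prodr_split_commuting (f := id) (a := A)); last first.
  by move=> B /sl Bl; apply: lC => //; rewrite mem_head.
rewrite (prodr_split_commuting (f := rho) (a := A)); last first.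
  by move=> B _; apply: mulrC.
set t := [seq B <- s | B != A]; have {}lC' : `|\prod_(B <- t) B| <= C * \prod_(B <- t) rho B.
  apply: lC' => B; rewrite mem_filter => /andP[BA /sl].
  by rewrite inE (negPf BA).
apply: le_trans (mx_norm_mul _ _) _; rewrite -!mulrA ler_wpM2l//.
rewrite [C * _]mulrCA [leRHS]mulrA; apply: ler_pM => //; exact: AD.
Qed.

(** Starting from any left inverse of [x], the row is multiplied by one eigenprojection per matrix.
    Each fixes [x], which keeps the normalisation, and commutes with the other matrices, which keeps
    the earlier eigenvector equations. *)
Lemma common_left_eigenvector (R : realType) (m : nat) (l : seq 'M[R]_m.+1)
    (rho : 'M[R]_m.+1 -> R) (x : 'cV[R]_m.+1) :
  x != 0 ->
  (forall A, A \in l -> eigenvalue A (rho A)) ->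
  (forall A, A \in l -> eigen_degree A (real_complex R (rho A)) = 1%N) ->
  (forall A, A \in l -> A *m x = rho A *: x) ->
  (forall A B, A \in l -> B \in l -> A *m B = B *m A) ->
  exists2 phi : 'rV[R]_m.+1, phi *m x = 1%:M &
    forall A, A \in l -> phi *m A = rho A *: phi.
Proof.
move=> x0; elim: l => [|A l IHl] eigl degl xl lC.
  exists (pinvmx x) => //; rewrite mulVpmx//.
  by rewrite /row_full eqn_leq rank_leq_col lt0n mxrank_eq0.
have lAl B : B \in l -> B \in A :: l by move=> Bl; rewrite inE Bl orbT.
have Al : A \in A :: l by rewrite mem_head.
have [||||phi phix phil] := IHl.
- by move=> B /lAl/eigl.
- by move=> B /lAl/degl.
- by move=> B /lAl/xl.
- by move=> B B' /lAl Bl /lAl; apply: lC.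
have [P [Px PA PC]] := semisimple_eigenprojection (eigl A Al) (degl A Al) (xl A Al).
exists (phi *m P) => [|B]; first by rewrite -mulmxA Px.
rewrite inE => /orP[/eqP->|Bl]; first by rewrite -mulmxA PA -scalemxAr.
have AB : A *m B = B *m A by apply: lC => //; apply: lAl.
by rewrite -mulmxA (PC B AB) mulmxA phil// scalemxAl.
Qed.

(** * Normal matrices and the Euclidean norm *)

Lemma trmx_mul_self (K : comNzRingType) (n : nat) (v : 'cV[K]_n) :
  (v^T *m v) 0 0 = \sum_i v i 0 ^+ 2.
Proof. by rewrite mxE; apply: eq_bigr => i _; rewrite mxE. Qed.

Lemma trmx_mul_self_eq0 (K : realDomainType) (n : nat) (v : 'cV[K]_n) :
  (v^T *m v == 0) = (v == 0).
Proof.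
apply/eqP/eqP => [vv|->]; last by rewrite mulmx0.
apply/colP => i; rewrite mxE; apply/eqP; rewrite -sqrf_eq0.
move/(congr1 (fun M : 'M[K]_1 => M 0 0))/eqP: vv.
rewrite trmx_mul_self mxE psumr_eq0 => [/allP/(_ i)|j _]; last exact: sqr_ge0.
by rewrite mem_index_enum/= => /(_ isT).
Qed.

(** [N = B - a] is normal too, so [N^T u] and [N u] have the same Euclidean norm, here 0. *)
Lemma normal_eigenvector_tr (R : realType) (m : nat) (B : 'M[R]_m.+1) (a : R)
    (u : 'cV[R]_m.+1) :
  normal_real_mx B -> B *m u = a *: u -> u^T *m B = a *: u^T.
Proof.
move=> nB Bu; pose N := B - a%:M.
have nN : N *m N^T = N^T *m N.
  rewrite /N linearB/= tr_scalar_mx !mulmxBl !mulmxBr nB.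
  rewrite !scalar_mxC !opprB !addrA [LHS]addrAC [RHS]addrAC; congr (_ + _).
  exact: addrAC.
have Nu : N *m u = 0 by rewrite mulmxBl Bu mul_scalar_mx subrr.
have : N^T *m u = 0.
  apply/eqP; rewrite -trmx_mul_self_eq0 trmx_mul trmxK mulmxA -[_ *m N *m _]mulmxA.
  by rewrite nN -!mulmxA Nu !mulmx0.
move/(congr1 trmx); rewrite trmx_mul trmxK trmx0 mulmxBr mul_mx_scalar.
by move/eqP; rewrite subr_eq0 => /eqP.
Qed.

Section SumSquares.
Local Open Scope sesquilinear_scope.

Lemma trmxC_mul_self (C : numClosedFieldType) (n : nat) (v : 'cV[C]_n) :
  (v^t* *m v) 0 0 = \sum_i `|v i 0| ^+ 2.
Proof. by rewrite mxE; apply: eq_bigr => i _; rewrite !mxE normCKC. Qed.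

Lemma unitarymx_sum_sqr (C : numClosedFieldType) (n : nat) (P : 'M[C]_n)
    (v : 'cV[C]_n) :
  P \is unitarymx -> \sum_i `|(P *m v) i 0| ^+ 2 = \sum_i `|v i 0| ^+ 2.
Proof.
move=> PU; rewrite -!trmxC_mul_self trmx_mul map_mxM -mulmxA [_ *m (P *m v)]mulmxA.
have := PU; rewrite -trmxC_unitary => /unitarymxP; rewrite trmxCK => ->.
by rewrite mul1mx.
Qed.

(** By the spectral theorem [B] is unitarily diagonalisable: the unitary factors preserve the sum of
    squares, and the diagonal one scales each coordinate by at most [r]. *)
Lemma normalmx_sum_sqr_le (C : numClosedFieldType) (n : nat) (B : 'M[C]_n) (r : C)
    (v : 'cV[C]_n) :
  B \is normalmx -> (forall z, eigenvalue B z -> `|z| <= r) ->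
  \sum_i `|(B *m v) i 0| ^+ 2 <= r ^+ 2 * \sum_i `|v i 0| ^+ 2.
Proof.
move=> /orthomx_spectralP; set P := spectralmx B; set d := spectral_diag B => DB Br.
have PU : P \is unitarymx by exact: spectral_unitarymx.
have PV : invmx P \is unitarymx by rewrite invmx_unitary// trmxC_unitary.
(* Row [i] of [P] is a left eigenvector for [d 0 i], nonzero because [P] is invertible. *)
have d_le i : `|d 0 i| <= r.
  apply: Br; apply/eigenvalueP; exists (row i P).
    rewrite -row_mul DB mulmxA mulKVmx ?unitarymx_unit//.
    by rewrite row_mul row_diag_mx -scalemxAl -rowE.
  have : row_free P by rewrite row_free_unit unitarymx_unit.
  by move=> /row_freeP[Q PQ]; apply: contraTneq isT => /(congr1 (mulmx^~ Q));
    rewrite -row_mul PQ mul0mx => /rowP/(_ i)/eqP; rewrite !mxE eqxx oner_eq0.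
rewrite DB -!mulmxA unitarymx_sum_sqr// -(unitarymx_sum_sqr v PU) mulr_sumr.
apply: ler_sum => i _; rewrite mul_diag_mx mxE normrM exprMn ler_wpM2r ?exprn_ge0//.
by rewrite lerXn2r ?nnegrE// (le_trans _ (d_le i)).
Qed.

Lemma normal_real_mx_sum_sqr_le (R : realType) (m : nat) (B : 'M[R]_m.+1) (r : R)
    (v : 'cV[R]_m.+1) :
  normal_real_mx B ->
  (forall z, eigenvalue (complexify B) z -> `|z| <= r%:C%C) ->
  \sum_i (B *m v) i 0 ^+ 2 <= r ^+ 2 * \sum_i v i 0 ^+ 2.
Proof.
move=> nB Br.
have BC : complexify B \is normalmx.
  have BT : (complexify B)^t* = complexify B^T.
    by apply/matrixP => i j; rewrite !mxE; apply: conjc_real.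
  by apply/normalmxP; rewrite BT -!map_mxM nB.
have sqC (w : 'cV[R]_m.+1) :
    (\sum_i w i 0 ^+ 2)%:C%C = \sum_i `|map_mx (real_complex R) w i 0| ^+ 2.
  rewrite rmorph_sum; apply: eq_bigr => i _ /=.
  by rewrite mxE -normc_normE /= expr0n addr0 sqrtr_sqr -rmorphXn/= real_normK ?num_real.
have := normalmx_sum_sqr_le (map_mx (real_complex R) v) BC Br.
by rewrite -map_mxM -!sqC -rmorphXn -rmorphM lecR.
Qed.

End SumSquares.

Lemma eigenvalue_conj (K : fieldType) (n : nat) (S A : 'M[K]_n) (z : K) :
  S \in unitmx -> eigenvalue (invmx S *m A *m S) z -> eigenvalue A z.
Proof.
move=> SU /eigenvalueP[v vA v0]; apply/eigenvalueP; exists (v *m invmx S).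
  by rewrite scalemxAl -vA -!mulmxA mulmxV// mulmx1.
apply: contra v0 => /eqP vS; rewrite -[v]mulmx1 -(mulVmx SU) mulmxA vS.
by rewrite mul0mx.
Qed.

(** After conjugation by [S], Euclidean bounds multiply along a product without any loss; the change
    of norm and of basis is paid for only once. *)
Lemma bounded_normal_semigroup (R : realType) (m : nat) (F : set 'M[R]_m.+1)
    (S : 'M[R]_m.+1) :
  S \in unitmx ->
  (forall A, F A -> normal_real_mx (invmx S *m A *m S)) ->
  exists C, forall s : seq 'M[R]_m.+1, (forall A, A \in s -> F A) ->
    `|\prod_(A <- s) A| <= C * \prod_(A <- s) spectral_radius A.
Proof.
move=> SU nF.
have contract s : (forall A, A \in s -> F A) -> forall v : 'cV[R]_m.+1,
    \sum_i (invmx S *m (\prod_(A <- s) A) *m S *m v) i 0 ^+ 2 <=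
    (\prod_(A <- s) spectral_radius A) ^+ 2 * \sum_i v i 0 ^+ 2.
  elim: s => [|A s IHs] sF v.
    by rewrite !big_nil mulmx1 mulVmx// mul1mx expr1n mul1r.
  have FA : F A by apply: sF; rewrite mem_head.
  have -> : invmx S *m (\prod_(B <- A :: s) B) *m S *m v =
      invmx S *m A *m S *m (invmx S *m (\prod_(B <- s) B) *m S *m v).
    by rewrite big_cons -mulmxE !mulmxA mulmxK// -!mulmxA.
  have A_le z : eigenvalue (complexify (invmx S *m A *m S)) z ->
      `|z| <= (spectral_radius A)%:C%C.
    rewrite /complexify !map_mxM map_invmx => /eigenvalue_conj Az.
    by apply: eigenvalue_norm_le; apply: Az; rewrite map_unitmx.
  apply: le_trans (normal_real_mx_sum_sqr_le _ (nF A FA) A_le) _.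
  rewrite big_cons exprMn -[leRHS]mulrA ler_wpM2l ?sqr_ge0// IHs// => B Bs.
  by apply: sF; rewrite inE Bs orbT.
exists (m.+1%:R * (m.+1%:R * `|S|) * `|invmx S|) => s sF.
have r0 : 0 <= \prod_(A <- s) spectral_radius A.
  by rewrite prodr_ge0// => A _; exact: spectral_radius_ge0.
have T_le : `|invmx S *m (\prod_(A <- s) A) *m S| <=
    \prod_(A <- s) spectral_radius A.
  apply: mx_norm_le => // i j; rewrite -[leRHS]ger0_norm// -ler_sqr ?nnegrE//.
  rewrite !real_normK ?num_real//.
  (* On a basis vector, the estimate bounds the sum of squares of column [j], hence each of its
     entries. *)
  have := contract s sF (delta_mx j 0); rewrite -colE.
  rewrite [X in _ * X](bigD1 j)//= mxE !eqxx expr1n [X in _ + X]big1 ?addr0 ?mulr1; last first.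
    by move=> k kj; rewrite mxE (negPf kj) expr0n.
  apply: le_trans; rewrite (bigD1 i)//= [X in _ <= X ^+ 2 + _]mxE lerDl sumr_ge0// => k _.
  exact: sqr_ge0.
have -> : \prod_(A <- s) A =
    S *m (invmx S *m (\prod_(A <- s) A) *m S) *m invmx S.
  by rewrite !mulmxA mulmxV// mul1mx mulmxK.
apply: le_trans (mx_norm_mul _ _) _; rewrite [leRHS]mulrAC ler_wpM2r//.
rewrite -[leRHS]mulrA ler_wpM2l// (le_trans (mx_norm_mul _ _))//.
by rewrite ler_wpM2l// mulr_ge0.
Qed.

Theorem theorem13 (R : realType) (m : nat) (F : set 'M[R]_m.+1)
    (x : 'cV[R]_m.+1)
    (F_vandergraft : forall A : 'M[R]_m.+1, F A -> vandergraft A)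
    (x_neq0 : x != 0)
    (x_dominant : forall A : 'M[R]_m.+1, F A -> A *m x = spectral_radius A *: x)
    (F_cond : simultaneously_similar_to_normal F \/
              finite_commuting_semisimple F) :
  exists K : set 'cV[R]_m.+1,
    [/\ proper_cone K,
        forall A : 'M[R]_m.+1, F A -> invariant_under K A &
        interior K x].
Proof.
have rho0 A : F A -> 0 <= spectral_radius A by rewrite spectral_radius_ge0.
have [[S SU nF]|[/finite_seqP[l Fl] FC degF]] := F_cond.
  have [C FC] := bounded_normal_semigroup SU nF.
  (* [u] is the common eigenvector of the normal matrices [S^-1 A S], so [u^T] is a common left one;
     [phi] is [u^T S^-1] scaled by [1 / (u^T u)]. *)
  pose u := invmx S *m x.
  have xu : S *m u = x by rewrite mulmxA mulmxV// mul1mx.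
  have uu : (u^T *m u) 0 0 != 0.
    apply: contra x_neq0 => /eqP uu; rewrite -xu -[u](_ : 0 = _) ?mulmx0//.
    by apply/esym/eqP; rewrite -trmx_mul_self_eq0 [_ *m _]mx11_scalar uu raddf0.
  apply: (@invariant_cone_of_bounded_semigroup _ _ _ (@spectral_radius R m) _
    (((u^T *m u) 0 0)^-1 *: (u^T *m invmx S)) C) => //.
    by rewrite -scalemxAl -mulmxA -/u {2}[_ *m u]mx11_scalar scale_scalar_mx mulVf.
  move=> A FA; rewrite -scalemxAl scalerA mulrC -scalerA; congr (_ *: _).
  have Bu : invmx S *m A *m S *m u = spectral_radius A *: u.
    by rewrite -[_ *m S *m u]mulmxA xu -mulmxA x_dominant// -scalemxAr.
  have := normal_eigenvector_tr (nF A FA) Bu.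
  move/(congr1 (mulmx^~ (invmx S))).
  by rewrite !mulmxA mulmxK// -scalemxAl.
have lF A : A \in l -> F A by rewrite Fl.
have [A /lF FA|A /lF FA|A /lF FA|A B /lF FA /lF FB|phi phix phil] :=
  @common_left_eigenvector R m l (@spectral_radius R m) x x_neq0.
- by have [] := F_vandergraft A FA.
- exact: degF.
- exact: x_dominant.
- exact: FC.
have [A /lF FA|A B /lF FA /lF FB|A /lF FA|C lC] :=
  @bounded_commuting_semigroup R m l (@spectral_radius R m).
- exact: rho0.
- exact: FC.
(* The Vandergraft condition carries degree one from [rho(A)] over to every peripheral
   eigenvalue. *)
- apply: power_bounded_of_degree => z Az Az_rho.
  by rewrite -(degF A FA); apply: (F_vandergraft A FA).2.
apply: (@invariant_cone_of_bounded_semigroup _ _ _ (@spectral_radius R m) _ phi C) => //.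
  by move=> A FA; apply: phil; rewrite Fl in FA.
by move=> s sF; apply: lC => A /sF; rewrite Fl.
Qed.
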